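(* Let $\kappa$ be a regular uncountable cardinal and $\lambda>\kappa$ a cardinal. If $\lambda\ge\overline{\mathfrak d}_\kappa$ (in particular, if $\lambda\geq\mathfrak d_\kappa$), then it is not the case that $I_{\kappa,\lambda}^+\xrightarrow{\kappa}(I_{\kappa,\lambda}^+,3)^2$.
   Context: For a cardinal $\mu$ and a set $A$, $P_\mu(A)=\{a\subseteq A:|a|<\mu\}$. $I_{\kappa,\lambda}$ is the set of all $A\subseteq P_\kappa(\lambda)$ such that $A\cap\{b\in P_\kappa(\lambda):a\subseteq b\}=\emptyset$ for some $a\in P_\kappa(\lambda)$; $I_{\kappa,\lambda}^+$ is the set of subsets of $P_\kappa(\lambda)$ not in $I_{\kappa,\lambda}$. $\mathfrak d_\kappa$ is the least cardinality of an $X\subseteq{}^\kappa\kappa$ such that for every $g\in{}^\kappa\kappa$ there is $f\in X$ with $g(\alpha)<f(\alpha)$ for all $\alpha<\kappa$. $\overline{\mathfrak d}_\kappa$ is the least cardinality of an $X\subseteq{}^\kappa\kappa$ such that for every $g\in{}^\kappa\kappa$ there is $x\in P_\kappa(X)$ with $g(\alpha)<\bigcup_{f\in x}f(\alpha)$ for all $\alpha<\kappa$. For $A\subseteq P_\kappa(\lambda)$, $[A]^2_\kappa=\{(\bigcup(a\cap\kappa),b):a,b\in A,\ \bigcup(a\cap\kappa)<\bigcup(b\cap\kappa)\}$. For $a,b\in P_\kappa(\lambda)$, $a\prec b$ means $a\subseteq b$ and $\bigcup(a\cap\kappa)<\bigcup(b\cap\kappa)$. $I_{\kappa,\lambda}^+\xrightarrow{\kappa}(I_{\kappa,\lambda}^+,\alpha)^2$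 means: for every $F:[P_\kappa(\lambda)]^2_\kappa\to2$ and every $A\in I_{\kappa,\lambda}^+$ there is $B\subseteq A$ such that either $B\in I_{\kappa,\lambda}^+$ and $F$ is identically $0$ on $[B]^2_\kappa$, or $(B,\prec)$ has order type $\alpha$ and $F$ is identically $1$ on $[B]^2_\kappa$. *)

(* Defs.v *)
From mathcomp Require Import all_boot all_order.
From mathcomp Require Import boolp classical_sets functions cardinality wochoice.

Set Implicit Arguments.
Unset Strict Implicit.
Unset Printing Implicit Defensive.

Import Order.TTheory.
Local Open Scope classical_set_scope.
Local Open Scope card_scope.
Local Open Scope order_scope.

(* Ordinals are elements of a type [Ord] that is well-ordered by [<=]. An ordinal
   [x] is identified with the set [seg x] of its predecessors. Every ordinal is
   isomorphic to an element of some such [Ord], so that quantifying over [Ord]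
   covers all pairs of ordinals. *)

Definition card_lt T U (A : set T) (B : set U) : Prop :=
  A #<= B /\ A #!= B.

Section Ordinals.
Context {d : Order.disp_t} {Ord : orderType d}.

Definition seg (x : Ord) : set Ord := [set y | y < x].

(* Since ordinals are sets of smaller ordinals, the union of a set of ordinals
   is its least upper bound, and the empty union is the least ordinal. The
   value [x0] is only used for sets that have no upper bound in [Ord]. *)
Definition ord_union (x0 : Ord) (S : set Ord) : Ord := xget x0 (supremums S).

Definition is_cardinal (mu : Ord) : Prop :=
  forall x, x < mu -> card_lt (seg x) (seg mu).

Definition cofinal_in (mu : Ord) (S : set Ord) : Prop :=
  S `<=` seg mu /\ forall x, x < mu -> exists2 y, S y & x <= y.

Definition is_regular (mu : Ord) : Prop :=
  [/\ is_cardinal mu, infinite_set (seg mu) &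
      forall S, cofinal_in mu S -> S #= seg mu].

Definition Psub (mu : Ord) {T : Type} (A : set T) : set (set T) :=
  [set a | a `<=` A /\ card_lt a (seg mu)].

End Ordinals.

Section Pkl.
Context {d : Order.disp_t} {Ord : orderType d}.
Context (kappa lambda : Ord).

Let Pkl : set (set Ord) := Psub kappa (seg lambda).

Definition bounded_ideal : set (set (set Ord)) :=
  [set A | A `<=` Pkl /\
     exists2 a, Pkl a & A `&` [set b | Pkl b /\ a `<=` b] = set0].

Definition bounded_ideal_pos : set (set (set Ord)) :=
  [set A | A `<=` Pkl /\ ~ bounded_ideal A].

Definition trace (a : set Ord) : Ord := ord_union kappa (a `&` seg kappa).

Definition square (A : set (set Ord)) : set (Ord * set Ord) :=
  [set p | exists a b,
     [/\ A a, A b, trace a < trace b & p = (trace a, b)]].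

Definition prec (a b : set Ord) : Prop := a `<=` b /\ trace a < trace b.

(* The ordinal alpha of the partition relation is given by its order type,
   as the type [W]. *)
Definition has_order_type {T : Type} (B : set T) (R : T -> T -> Prop)
    {d' : Order.disp_t} (W : orderType d') : Prop :=
  exists2 f : W -> T, set_bij [set: W] B f &
    forall v w : W, v < w <-> R (f v) (f w).

(* The two colours 0 and 1 are [false] and [true]. *)
Definition pos_arrow {d' : Order.disp_t} (W : orderType d') : Prop :=
  forall (F : square Pkl -> bool) (A : set (set Ord)), bounded_ideal_pos A ->
  exists2 B : set (set Ord), B `<=` A &
    (bounded_ideal_pos B /\
       forall p : square Pkl, square B (val p) -> F p = false) \/
    (has_order_type B prec W /\
       forall p : square Pkl, square B (val p) -> F p = true).

End Pkl.

Section Domination.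
Context {d : Order.disp_t} {Ord : orderType d}.
Context (kappa : Ord).

Definition dominating (X : set (seg kappa -> seg kappa)) : Prop :=
  forall g : seg kappa -> seg kappa,
  exists2 f, X f & forall i, val (g i) < val (f i).

Definition weakly_dominating (X : set (seg kappa -> seg kappa)) : Prop :=
  forall g : seg kappa -> seg kappa,
  exists2 x, Psub kappa X x &
    forall i, val (g i) < ord_union kappa [set val (f i) | f in x].

End Domination.

Arguments dominating {d Ord} kappa X.
Arguments weakly_dominating {d Ord} kappa X.

(* [C] has the least cardinality among the sets satisfying [P]; cardinal
   characteristics are represented by such sets. *)
Definition least_card {T : Type} (P : set T -> Prop) (C : set T) : Prop :=
  P C /\ forall X, P X -> C #<= X.

(* Main.v *)
Require Import Defs.
From mathcomp Require Import all_boot all_order.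
From mathcomp Require Import boolp classical_sets functions cardinality wochoice.

Set Implicit Arguments.
Unset Strict Implicit.
Unset Printing Implicit Defensive.

Import Order.TTheory.
Local Open Scope classical_set_scope.
Local Open Scope card_scope.
Local Open Scope order_scope.

(** Fix a function [r] from [kappa] to [kappa] with unbounded fibres and a
    weakly dominating family coded by elements of [lambda]. For [b] in
    P_kappa(lambda) let [f_b] be the pointwise supremum of the functions coded
    in [b]; it increases with [b]. Let [A] consist of the [b] such that
    [r (trace b) = f_b 0] and [f_b (f_b 0) < trace b], and give the pair
    [(x, b)] colour 1 exactly when [r (trace b) < r x].

    If [a] is included in [b], both in [A], then
    [r (trace a) = f_a 0 <= f_b 0 = r (trace b)], so that no set with
    [a] below [b] is homogeneous of colour 1.

    If [B] is a cofinal subset of [A], let [h o] be the trace of some [a] in [B]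
    with [o < r (trace a)]. Any large [b] in [B] has [h o < f_b o] for all [o].
    At [o = f_b 0] this gives [trace a < f_b (f_b 0) < trace b] and
    [r (trace b) < r (trace a)], a pair of colour 1. *)

(** * Cardinal comparison through total functions *)

Lemma card_le_injP {T U : Type} {A : set T} {B : set U} (u : U) : A #<= B ->
  exists2 c : T -> U, {in A &, injective c} & forall t, A t -> B (c t).
Proof.
case/card_leP => f.
(* The value [u] is taken only outside [A]. *)
pose c t := if pselect (A t) is left At then val (f (SigSub (mem_set At))) else u.
exists c => [s t /set_mem As /set_mem At|t At].
- rewrite /c; case: pselect => // As'; case: pselect => // At' /val_inj fst.
  by have [] : SigSub (mem_set As') = SigSub (mem_set At')
    by apply: (inj (f := f)) => //; rewrite inE.
- by rewrite /c; case: pselect => // At'; apply: set_mem; apply: valP.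
Qed.

Lemma inj_card_leW {T U : Type} {A : set T} {B : set U} (c : T -> U) :
  {in A &, injective c} -> (forall t, A t -> B (c t)) -> A #<= B.
Proof.
move=> /inj_card_eq/card_eqPle[_ cA] AB; apply: card_le_trans cA _.
by apply: subset_card_le => _ [t At <-]; apply: AB.
Qed.

Arguments inj_card_leW {T U A B} c.

Lemma card_le_ltW {T U V : Type} {A : set T} {B : set U} {C : set V} :
  A #<= B -> card_lt B C -> card_lt A C.
Proof.
move=> AB [BC nBC]; split; first exact: card_le_trans AB BC.
apply: contra nBC => /card_eqPle[_ CA].
by apply: Cantor_Bernstein BC _; apply: card_le_trans CA AB.
Qed.

(** * Suprema and recursion in a well-ordered type *)

Section WellOrder.
Context {d : Order.disp_t} {Ord : orderType d}.
Context (Ord_wo : well_order (<=%O : rel Ord)).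

Lemma least_ex (P : set Ord) :
  P !=set0 -> exists2 x, P x & forall y, P y -> x <= y.
Proof.
case=> x Px; have [|z [[zP zmin] _]] := @Ord_wo (fun y => `[< P y >]).
  by exists x; apply/asboolP.
exists z; first exact/asboolP.
by move=> y Py; apply: zmin; apply/asboolP.
Qed.

Lemma ord_lt_wf : well_founded (fun x y : Ord => x < y).
Proof.
move=> x; apply: contrapT => nx.
have [|y ny ymin] := @least_ex [set y | ~ Acc (fun x y : Ord => x < y) y].
  by exists x.
apply: ny; constructor => w wy; apply: contrapT => /ymin.
by rewrite leNgt wy.
Qed.

(** Well-ordering gives every bounded set a least upper bound, so the default [x0] does not come
    into play. *)
Lemma ord_unionP (x0 u : Ord) (S : set Ord) :
  ubound S u -> supremums S (ord_union x0 S).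
Proof.
move=> Su; apply: xgetPex.
have [|s sub smin] := @least_ex (ubound S); first by exists u.
by exists s.
Qed.

(* A pair [m], [x] is pending at [g] when the fibre of [x] below [g] is still
   bounded by [m]. *)
Definition pending (r : Ord -> Ord) (g m x : Ord) : Prop :=
  x <= m /\ forall y, y < g -> r y = x -> y < m.

(* At each [g] the recursion serves a pending pair of least bound [m]. *)
Lemma serving_function_ex : exists r : Ord -> Ord, forall g,
  exists2 m, pending r g m (r g) & forall m' x, pending r g m' x -> m <= m'.
Proof.
(* [pend] is [pending] for a function known only below [g], as recursion requires. *)
pose pend g (r : forall y, y < g -> Ord) m x :=
  x <= m /\ forall y (yg : y < g), r y yg = x -> y < m.
pose step g (r : forall y, y < g -> Ord) : Ord := xget g
  [set x | exists2 m, pend g r m x & forall m' x', pend g r m' x' -> m <= m'].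
pose r := Fix ord_lt_wf (fun=> Ord) step.
have step_ext g u v : (forall y (yg : y < g), u y yg = v y yg) ->
    step g u = step g v.
  by move=> uv; congr (step g _); apply: functional_extensionality_dep => y;
     apply: functional_extensionality_dep => yg; apply: uv.
have rE g : r g = step g (fun y _ => r y) :=
  Fix_eq ord_lt_wf (fun=> Ord) step step_ext g.
exists r => g.
have [|m [x px] mmin] :=
  @least_ex [set m | exists x, pend g (fun y _ => r y) m x].
  (* Some pair is always pending at [g]: the value [g] with bound [g]. *)
  by exists g, g.
have [m' [p1 p2] m'min] : exists2 m, pend g (fun y _ => r y) m (r g) &
    forall m' x', pend g (fun y _ => r y) m' x' -> m <= m'.
  rewrite rE; apply: (@xgetPex _ g [set x | exists2 m, _ m x & _]).
  by exists x, m => // m' x' px'; apply: mmin; exists x'.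
exists m'; first by split => // y yg; apply: p2.
by move=> m'' x' [q1 q2]; apply: (m'min _ x'); split.
Qed.

(** * Regular cardinals and functions with unbounded fibres *)

Section Regular.
Context (kappa : Ord) (kappa_reg : is_regular kappa).

Lemma not_card_le_seg x : x < kappa -> ~ (seg kappa #<= seg x).
Proof.
case: kappa_reg => kcard _ _ /kcard [xk nxk] kx.
by move: nxk; rewrite card_eq_sym (Cantor_Bernstein kx xk).
Qed.

Lemma regular_no_max x : x < kappa -> exists2 y, y < kappa & x < y.
Proof.
move=> xk; apply: contrapT => nex.
case: kappa_reg => _ kinf /(_ [set x]) ksing.
have /card_eqPle[_ kx] : [set x] #= seg kappa.
  apply: ksing; split=> [_ -> //|y yk]; exists x => //.
  by rewrite leNgt; apply/negP => xy; apply: nex; exists y.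
by apply: kinf; apply: card_le_finite kx _; apply: finite_set1.
Qed.

Lemma small_bounded {T : Type} (a : set T) (g : T -> Ord) :
  card_lt a (seg kappa) -> (forall t, a t -> g t < kappa) ->
  exists2 x, x < kappa & forall t, a t -> g t < x.
Proof.
move=> [ak nak] gk; apply: contrapT => nex.
have /card_eqPle[_ kg] : g @` a #= seg kappa.
  case: kappa_reg => _ _; apply; split=> [_ [t at_ <-]|x xk]; first exact: gk.
  apply: contrapT => nx; apply: nex; exists x => // t at_.
  by rewrite ltNge; apply/negP => xg; apply: nx; exists (g t) => //; exists t.
move/negP: nak; apply.
by apply: Cantor_Bernstein ak (card_le_trans kg (card_image_le _ _)).
Qed.

Lemma small_adjoin (a : set Ord) (z : Ord) :
  card_lt a (seg kappa) -> card_lt (a `|` [set z]) (seg kappa).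
Proof.
move=> [ak nak]; split.
- have [c cinj ck] := card_le_injP kappa ak.
  have [az|naz] := pselect (a z).
    by apply: card_le_trans ak; apply: subset_card_le => x [//|->].
  (* If [c] left no [p] free, it would map [a] onto kappa. *)
  have [p pk np] : exists2 p, p < kappa & forall x, a x -> c x <> p.
    apply: contrapT => nex; move/negP: nak; apply; apply: Cantor_Bernstein ak _.
    apply: card_le_trans (card_image_le c a).
    apply: subset_card_le => p pk; apply: contrapT => np; apply: nex.
    by exists p => // x ax cx; apply: np; exists x.
  pose c' x := if x == z then p else c x.
  apply: (inj_card_leW c') => [x y /set_mem xa /set_mem ya|x].
    rewrite /c'; case: eqVneq => [->|/eqP xz]; case: eqVneq => [->|/eqP yz] //.
    - by case: ya => // ay /esym /(np _ ay).
    - by case: xa => // ax /(np _ ax).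
    - by case: xa => // ax; case: ya => // ay; apply: cinj; apply: mem_set.
  by rewrite /c'; case: eqVneq => // /eqP xz [/ck|].
- apply/negP => /card_eqPle[_ ka].
  have [c cinj ca] := card_le_injP z ka.
  (* [S] omits at most one point of kappa, because [c] is injective. As kappa has no maximum, [S] is
     still cofinal, hence of full size. *)
  pose S := [set x | x < kappa /\ c x <> z].
  have Sa : S #<= a.
    apply: (inj_card_leW c) => [x y /set_mem[xk _] /set_mem[yk _]|x [/ca []//]].
    by apply: cinj; apply: mem_set.
  have /card_eqPle[_ kS] : S #= seg kappa.
    case: kappa_reg => _ _; apply; split=> [x []//|x xk].
    have [cxz|] := pselect (c x = z); last by exists x.
    have [y yk xy] := regular_no_max xk; exists y; last exact: ltW.
    split=> // cyz; move: xy; have -> : x = y by apply: cinj; rewrite ?inE ?cxz.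
    by rewrite ltxx.
  move/negP: nak; apply; apply: Cantor_Bernstein ak _.
  exact: card_le_trans kS Sa.
Qed.

(** If the fibre of [x] stopped below [e], then [x] with bound [m0] would be pending at every [g]
    below kappa, so every value served would have bound at most [m0]. A value taken at or after [m0]
    could then never be served again, making [r] injective from a final segment of kappa into the
    ordinals up to [m0]. *)
Lemma unbounded_fibres_ex : exists r : Ord -> Ord, forall x e,
  x < kappa -> e < kappa -> exists2 g, e <= g < kappa & r g = x.
Proof.
have [r rP] := serving_function_ex; exists r => x e xk ek.
apply: contrapT => nex; pose m0 := Order.max x e.
have m0k : m0 < kappa by rewrite gt_max xk.
have rm g : g < kappa -> exists2 m, pending r g m (r g) & m <= m0.
  move=> gk; have [m pm mmin] := rP g; exists m => //; apply: (mmin _ x).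
  split=> [|y yg ryx]; first by rewrite le_max lexx.
  rewrite lt_max (ltNge y e); apply/orP; right; apply/negP => ey; apply: nex.
  by exists y => //; rewrite ey (lt_trans yg).
have [m1 m1k m01] := regular_no_max m0k.
apply: (not_card_le_seg m1k).
pose S := [set g | m0 <= g < kappa].
have /card_eqPle[_ kS] : S #= seg kappa.
  case: kappa_reg => _ _; apply; split=> [g /andP[]//|g gk].
  exists (Order.max m0 g); last by rewrite le_max lexx orbT.
  by rewrite /S /= le_max lexx gt_max m0k.
apply: card_le_trans kS _; apply: (inj_card_leW r) => [g h|g /andP[_ gk]].
- have rlt g1 g2 : S g1 -> S g2 -> g1 < g2 -> r g1 <> r g2.
    move=> /andP[mg1 _] /andP[_ g2k] lt12 rE.
    have [m [_ /(_ _ lt12 rE) g1m] mm0] := rm _ g2k.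
    by move: (lt_le_trans g1m mm0); rewrite ltNge mg1.
  move=> /set_mem Sg /set_mem Sh rgh; case: (ltgtP g h) => // lt.
  + by case: (rlt _ _ Sg Sh lt).
  + by case: (rlt _ _ Sh Sg lt).
- by have [m [rgm _] mm0] := rm _ gk; exact: le_lt_trans (le_trans rgm mm0) m01.
Qed.

(** * Traces of elements of P_kappa(lambda) *)

Section Trace.
Context (lambda : Ord) (kappa_lt : kappa < lambda).

Notation Pkl := (Psub kappa (seg lambda)).

Lemma trace_supremum b : Pkl b ->
  trace kappa b < kappa /\ supremums (b `&` seg kappa) (trace kappa b).
Proof.
move=> [_ bsm].
have [|x xk xub] := @small_bounded _ (b `&` seg kappa) id _ (fun _ xx => proj2 xx).
  exact: card_le_ltW (subset_card_le (@subIsetl _ _ _)) bsm.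
have [sub slub] : supremums (b `&` seg kappa) (trace kappa b).
  by apply: (@ord_unionP _ x) => t /xub /ltW.
by split=> //; apply: le_lt_trans xk; apply: slub => t /xub /ltW.
Qed.

Lemma trace_lt b : Pkl b -> trace kappa b < kappa.
Proof. by case/trace_supremum. Qed.

Lemma le_trace b x : Pkl b -> b x -> x < kappa -> x <= trace kappa b.
Proof. by move=> /trace_supremum[_ [ub _]] bx xk; apply: ub. Qed.

Lemma trace_mono a b : Pkl a -> Pkl b -> a `<=` b ->
  trace kappa a <= trace kappa b.
Proof.
move=> /trace_supremum[_ [_ lub]] Pb ab; apply: lub => x [/ab bx xk].
exact: le_trace.
Qed.

Lemma Pkl_adjoin y g : Pkl y -> g < kappa -> Pkl (y `|` [set g]).
Proof.
move=> [yl ysm] gk; split; last exact: small_adjoin.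
by move=> x [/yl//|->]; apply: lt_trans kappa_lt.
Qed.

(** This allows an extension of [y] to be given any prescribed larger trace. *)
Lemma trace_adjoin y g : Pkl y -> g < kappa -> trace kappa y < g ->
  trace kappa (y `|` [set g]) = g.
Proof.
move=> Py gk yg; apply/eqP; rewrite eq_le; apply/andP; split; last first.
  by apply: le_trace => //; [exact: Pkl_adjoin|right].
have [_ [_]] := trace_supremum (Pkl_adjoin Py gk); apply => x [[yx xk|->//]].
exact: le_trans (le_trace Py yx xk) (ltW yg).
Qed.

(** * Functions coded by elements of P_kappa(lambda) *)

Section Diagonal.
Context (X : set (seg kappa -> seg kappa)) (z : seg kappa).
Context (c : (seg kappa -> seg kappa) -> Ord) (c_inj : {in X &, injective c}).
Context (c_lt : forall f, X f -> c f < lambda).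

Definition ext (f : seg kappa -> seg kappa) (o : Ord) : Ord :=
  val (f (insubd z o)).

(* The function coded by the trace of [b] is left out so that adding a new
   trace to a set does not change the functions that it codes. *)
Definition coded (b : set Ord) : set (seg kappa -> seg kappa) :=
  [set f | [/\ X f, b (c f) & c f <> trace kappa b]].

Definition sup_coded (b : set Ord) (o : Ord) : Ord :=
  ord_union kappa [set ext f o | f in coded b].

Lemma sup_coded_supremum b o : Pkl b -> sup_coded b o < kappa /\
  supremums [set ext f o | f in coded b] (sup_coded b o).
Proof.
move=> [_ bsm].
have [||x xk xub] := @small_bounded _ (coded b) (ext^~ o).
- apply: card_le_ltW bsm; apply: (inj_card_leW c) => [f g|f []//].
  by move=> /set_mem[Xf _ _] /set_mem[Xg _ _]; apply: c_inj; apply: mem_set.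
- by move=> f _; exact: (set_mem (valP (f (insubd z o)))).
have ub : ubound [set ext f o | f in coded b] x by move=> _ [f /xub/ltW ? <-].
have sP := @ord_unionP kappa _ _ ub; split=> //.
by apply: le_lt_trans xk; case: sP => _; apply.
Qed.

Lemma sup_coded_lt b o : Pkl b -> sup_coded b o < kappa.
Proof. by move=> /(sup_coded_supremum o)[]. Qed.

Lemma le_sup_coded b f o : Pkl b -> coded b f -> ext f o <= sup_coded b o.
Proof. by move=> /(sup_coded_supremum o)[_ [ub _]] bf; apply: ub; exists f. Qed.

(** The only danger is a function coded in [a] whose code is the trace of [b]. That code lies in [a]
    and below kappa, so the two traces agree and the function was already left out for [a]. *)
Lemma sup_coded_mono a b o : Pkl a -> Pkl b -> a `<=` b ->
  sup_coded a o <= sup_coded b o.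
Proof.
move=> Pa Pb ab; have [_ [_]] := sup_coded_supremum o Pa; apply.
move=> _ [f [Xf af cf] <-]; apply: le_sup_coded => //.
split=> // [|cfb]; first exact: ab.
apply: cf; apply/eqP; rewrite eq_le le_trace //= ?cfb ?trace_lt //.
exact: trace_mono.
Qed.

(** The right-hand side does not mention [g]: the only possible new code is [g], which is excluded
    as the new trace. *)
Lemma coded_adjoin y g : Pkl y -> g < kappa -> trace kappa y < g ->
  coded (y `|` [set g]) = [set f | X f /\ y (c f)].
Proof.
move=> Py gk yg; apply/seteqP; rewrite /coded trace_adjoin //.
split=> f [Xf]; first by case.
move=> yf; split=> //; first by left.
by move=> cfg; move: (le_trace Py yf); rewrite cfg leNgt yg => /(_ gk).
Qed.

Lemma weakly_dominating_sup_coded (h : Ord -> Ord) :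
  weakly_dominating kappa X -> (forall o, o < kappa -> h o < kappa) ->
  exists2 y, Pkl y & forall b, Pkl b -> y `<=` b ->
    forall o, o < kappa -> h o < sup_coded b o.
Proof.
move=> Xdom hk.
have [x [xX xsm] xh] := Xdom (fun i => insubd z (h (val i))).
have Py : Pkl (c @` x).
  split; first by move=> _ [f /xX/c_lt ? <-].
  exact: card_le_ltW (card_image_le _ _) xsm.
(* Adjoining [g] lifts the trace of every [b] above the codes of [x] that lie below kappa, so none
   of them is left out of [coded b]. *)
have [g gk yg] := regular_no_max (trace_lt Py).
exists ((c @` x) `|` [set g]); first exact: Pkl_adjoin.
move=> b Pb yb o ok; have bx : x `<=` coded b.
  move=> f xf; split; [exact: xX | by apply: yb; left; exists f |].
  have cfy : (c @` x) (c f) by exists f.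
  move=> cfb; have := le_trace Py cfy; rewrite cfb trace_lt // => /(_ isT).
  apply/negP; rewrite -ltNge; apply: lt_le_trans yg _.
  by apply: le_trace => //; apply: yb; right.
have oE : val (insubd z o) = o by rewrite val_insubd mem_set.
have := xh (insubd z o); rewrite val_insubd oE.
rewrite (mem_set (hk _ ok : seg kappa (h o))) => /lt_le_trans; apply.
have ub : ubound [set val (f (insubd z o)) | f in x] (sup_coded b o).
  by move=> _ [f /bx bf <-]; apply: le_sup_coded.
by have [_] := @ord_unionP kappa _ _ ub; apply.
Qed.

(** * The colouring and its homogeneous sets *)

Lemma bounded_ideal_pos_cofinal B y :
  bounded_ideal_pos kappa lambda B -> Pkl y -> exists2 b, B b & y `<=` b.
Proof.
move=> [BP Bpos] Py; apply: contrapT => nex; apply: Bpos; split=> //.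
exists y => //; rewrite -subset0 => b [Bb [_ yb]]; apply: nex; by exists b.
Qed.

Lemma weakly_dominating_not_arrow :
  weakly_dominating kappa X -> ~ pos_arrow kappa lambda ('I_3 : orderType _).
Proof.
move=> Xdom arrow; have [r rfib] := unbounded_fibres_ex.
pose F (p : square kappa Pkl) := r (trace kappa (val p).2) < r (val p).1.
(* The point [z] takes the place of 0 in the overview. *)
pose s b := sup_coded b (val z).
pose A := [set b | [/\ Pkl b, r (trace kappa b) = s b &
  sup_coded b (s b) < trace kappa b]].
have zk : val z < kappa := set_mem (valP z).
(* On [A], [r] of the trace is [s], so colours compare values of [s]. *)
have FP (B : set (set Ord)) a b (c0 : bool) : B `<=` A ->
    (forall p : square kappa Pkl, square kappa B (val p) -> F p = c0) ->
    B a -> B b -> trace kappa a < trace kappa b -> (s b < s a) = c0.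
  move=> BA FB Ba Bb ab.
  have [[Pa ra _] [Pb rb _]] := (BA _ Ba, BA _ Bb).
  have sq (D : set (set Ord)) :
    D a -> D b -> square kappa D (trace kappa a, b) by exists a, b.
  have := FB (SigSub (mem_set (sq _ Pa Pb))) (sq _ Ba Bb).
  by rewrite /F /= ra rb.
have Apos : bounded_ideal_pos kappa lambda A.
  split=> [b []//|[_ [y Py]]]; apply/eqP/set0P.
  have [g0 g0k yg0] := regular_no_max (trace_lt Py).
  (* The auxiliary [b0] reveals the functions coded by any one-point extension of [y] with larger
     trace. Knowing them, one picks [g] above [m] in the fibre of [s b0], and [g] becomes the
     trace. *)
  pose b0 := y `|` [set g0]; have Pb0 : Pkl b0 by exact: Pkl_adjoin.
  pose m := Order.max g0 (sup_coded b0 (s b0)).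
  have mk : m < kappa by rewrite gt_max g0k sup_coded_lt.
  have [e ek me] := regular_no_max mk.
  have [g /andP[eg gk] rg] := rfib _ _ (sup_coded_lt (val z) Pb0) ek.
  have mg := lt_le_trans me eg.
  have yg : trace kappa y < g.
    by apply: lt_trans yg0 _; move: mg; rewrite gt_max => /andP[].
  pose b := y `|` [set g]; have Pb : Pkl b by exact: Pkl_adjoin.
  have bE : sup_coded b = sup_coded b0.
    by rewrite /sup_coded /b /b0 !coded_adjoin.
  exists b; split; last by split=> // x; left.
  rewrite /A /= /s bE /b trace_adjoin //; split=> //.
  by move: mg; rewrite gt_max => /andP[].
have [B BA [[Bpos FB]|[[f [fB _ _] fprec] FB]]] := arrow F A Apos.
- have BP b : B b -> Pkl b by move=> /BA[].
  pose T o := [set g | exists a, [/\ B a, trace kappa a = g & o < s a]].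
  pose h o := xget (val z) (T o).
  have Th o : o < kappa -> T o (h o).
    move=> ok; apply: xgetPex.
    (* Dominating the constant function [o] at [z] yields [o < s a] for all large [a]. *)
    have [//|y Py ydom] := @weakly_dominating_sup_coded (fun=> o) Xdom.
    have [a Ba ya] := bounded_ideal_pos_cofinal Bpos Py.
    by exists (trace kappa a), a; split=> //; apply: ydom => //; apply: BP.
  have [o /Th[a [/BP Pa <- _]]|y Py ydom] := @weakly_dominating_sup_coded h Xdom.
    exact: trace_lt.
  have [b Bb yb] := bounded_ideal_pos_cofinal Bpos Py.
  have sk : s b < kappa by apply: sup_coded_lt; apply: BP.
  have [a [Ba ha sba]] := Th _ sk.
  have [Pb _ hb] := BA _ Bb.
  have ab : trace kappa a < trace kappa b.
    by rewrite ha; apply: lt_trans hb; apply: ydom.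
  by move: (FP _ _ _ _ BA FB Ba Bb ab); rewrite sba.
- pose i0 : 'I_3 := ord0; pose i1 : 'I_3 := Ordinal (isT : (1 < 3)%N).
  have [sub01 tr01] : prec kappa (f i0) (f i1) by apply/fprec.
  have [Ba Bb] : B (f i0) /\ B (f i1) by split; apply: fB.
  have := FP _ _ _ _ BA FB Ba Bb tr01; rewrite ltNge /s sup_coded_mono //.
  + by have [] := BA _ Ba.
  + by have [] := BA _ Bb.
Qed.

End Diagonal.

End Trace.

(** * Dominating families and the conclusion *)

Lemma dominating_weakly_dominating (X : set (seg kappa -> seg kappa)) :
  dominating kappa X -> weakly_dominating kappa X.
Proof.
move=> Xdom g; have [f Xf gf] := Xdom g; exists [set f].
  split=> [_ -> //|]; case: kappa_reg => _ kinf _.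
  have k0 : card_lt (set0 : set Ord) (seg kappa).
    split; first by apply: subset_card_le; exact: sub0set.
    apply/negP; rewrite card_eq_sym card_eq0 => /eqP k0.
    by apply: kinf; rewrite k0.
  (* [small_adjoin] concerns sets of ordinals, so the singleton of [f] is compared with that of
     [kappa]. *)
  apply: card_le_ltW (small_adjoin kappa k0); rewrite set0U.
  by apply: (inj_card_leW (fun=> kappa)) => // f1 f2 /set_mem-> /set_mem->.
move=> i; rewrite image_set1 /ord_union supremums1.
by rewrite (@xget_unique _ _ _ (val (f i))).
Qed.

Lemma card_le_seg_not_arrow (lambda : Ord) (X : set (seg kappa -> seg kappa)) :
  kappa < lambda -> weakly_dominating kappa X -> X #<= seg lambda ->
  ~ pos_arrow kappa lambda ('I_3 : orderType _).
Proof.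
move=> kl Xdom /(card_le_injP kappa)[c c_inj c_lt].
have /set0P[x xk] : seg kappa != set0.
  by apply/eqP => k0; case: kappa_reg => _ + _; rewrite k0; apply.
exact: (@weakly_dominating_not_arrow _ kl X (SigSub (mem_set xk)) c).
Qed.

End Regular.
End WellOrder.

Theorem mainTheorem5 (d : Order.disp_t) (Ord : orderType d)
  (Ord_wo : well_order (<=%O : rel Ord)) (kappa lambda : Ord)
  (kappa_reg : is_regular kappa) (kappa_unc : ~ countable (seg kappa))
  (lambda_card : is_cardinal lambda) (kappa_lt : kappa < lambda) :
  (forall dbar : set (seg kappa -> seg kappa),
     least_card (weakly_dominating kappa) dbar -> dbar #<= seg lambda ->
     ~ pos_arrow kappa lambda ('I_3 : orderType _)) /\
  (forall dk : set (seg kappa -> seg kappa),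
     least_card (dominating kappa) dk -> dk #<= seg lambda ->
     ~ pos_arrow kappa lambda ('I_3 : orderType _)).
Proof.
split=> X [Xdom _]; apply: card_le_seg_not_arrow => //.
exact: dominating_weakly_dominating.
Qed.
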